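(* Let $m\ge 4$ be an integer and let $d=\gcd(3^m-2^m,\,2^m-1)$. Let $l_3=\frac{3^m-1}{d}$ and $l_4=2^m+1$. Given the four values $l_3,\ l_4,\ 2l_3,\ 2l_4$, the second smallest of these values is the seed number $S(m,3)$, and the seed value is $V(m,3)=S(m,3)\cdot 2^m$.
   Context: For positive integers $n,m,t$, $T(n,m,t)$ denotes the least number that is the sum of $n$ positive $m$th powers (i.e. $\sum_{i=1}^n a_i^m$ with all $a_i$ positive integers) in at least $t$ ways, provided such a number exists. Two ways are regarded as different if they differ as multisets of terms (order is irrelevant). The seed number $S(m,t)$ is the smallest positive integer $s_0$ such that $T(n+1,m,t)=T(n,m,t)+1$ for all $n\ge s_0$ (in particular these values of $T$ exist), and the seed value is $V(m,t)=T(S(m,t),m,t)$. *)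

(* Defs.v *)
From mathcomp Require Import all_boot.

Set Implicit Arguments.
Unset Strict Implicit.
Unset Printing Implicit Defensive.

Definition is_least (P : nat -> Prop) (x : nat) : Prop :=
  P x /\ forall y, P y -> x <= y.

(* A list of terms; the order is quotiented out in [at_least_ways]. *)
Definition is_way (n m x : nat) (a : seq nat) : bool :=
  [&& size a == n, all (fun i => 0 < i) a & \sum_(i <- a) i ^ m == x].

Definition at_least_ways (n m t x : nat) : Prop :=
  exists W : seq (seq nat),
    [/\ size W = t, all (is_way n m x) W
      & pairwise (fun a b => ~~ perm_eq a b) W].

(* T(n,m,t) = x: T is partial, hence a relation; it does not hold for any x
   when no number is a sum in at least t ways. *)
Definition is_T (n m t x : nat) : Prop :=
  is_least (at_least_ways n m t) x.

Definition seed_property (m t s0 : nat) : Prop :=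
  0 < s0 /\
  forall n, s0 <= n -> exists x, is_T n m t x /\ is_T n.+1 m t x.+1.

Definition is_seed_number (m t s : nat) : Prop :=
  is_least (seed_property m t) s.

Definition is_seed_value (m t v : nat) : Prop :=
  exists s, is_seed_number m t s /\ is_T s m t v.

(* Counted with multiplicity. *)
Definition second_smallest (s : seq nat) : nat := nth 0 (sort leq s) 1.

(* Main.v *)
Require Import Defs.
From mathcomp Require Import all_boot.
From mathcomp Require Import zify.

Set Implicit Arguments.
Unset Strict Implicit.
Unset Printing Implicit Defensive.

(** Replacing each term [i] of a sum of [n] positive [m]th powers by [i ^ m - 1]
    leaves an excess over [n].  Ones have excess 0 and only pad the list, so the
    question is which least excess [y] is a sum of parts [2 ^ m - 1], [3 ^ m - 1],
    [4 ^ m - 1], and so on, in three ways with at most [n] parts.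

    In the relevant range only terms up to 4 occur: the candidate excess is at
    most that of two fours, below that of one 5 because [2 * 4 ^ m <= 5 ^ m] for
    [4 <= m] ([small_way]).  Two trades relate the remaining parts: a least batch
    of threes is worth l_3 twos, their common excess being
    [lcmn (2 ^ m - 1) (3 ^ m - 1)], and one four is worth l_4 twos, as
    [4 ^ m - 1 = (2 ^ m + 1) * (2 ^ m - 1)].  The number of threes modulo a batch
    is determined by [y] ([eq_mod_copies]).  So if a way has residual threes and
    the rest of its excess is worth [z] twos, the ways of excess [y] correspond to
    the pairs (batches, fours) whose cost [k * l_3 + c * l_4] is at most [z]
    ([excess_code], [code_inj]).

    Three such pairs exist once [z] reaches the second smallest positive cost [s],
    which is among l_3, l_4, 2 l_3, 2 l_4.  Parity and congruences modulo 3 and 4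
    exclude ties between these values, so at [z = s] there are exactly three pairs,
    one of them [(0, 0)] ([seed_costs]).  Hence the least excess is
    [s * (2 ^ m - 1)], and the pair [(0, 0)] is a way with [s] twos.  All three ways
    fit into [n] terms if and only if [s <= n] ([three_ways_seed],
    [seed_optimal]).  Therefore [s] is the seed number, and the seed value is
    [s + s * (2 ^ m - 1) = s * 2 ^ m]. *)

(** * The four candidate values *)

Lemma second_smallest_pair a b :
  second_smallest [:: a; b; 2 * a; 2 * b]
    = if a < b then minn b (2 * a) else minn a (2 * b).
Proof.
rewrite /second_smallest /sort /=.
repeat (case: leqP => ? //=); lia.
Qed.

(** Read [a] and [b] as prices.  When there is no tie between the candidates,
    exactly three baskets [p] are affordable with the budget [s]: the empty one,
    the cheapest other one [u], and one that costs exactly [s].  A tie such as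
    [b = 2 * a] would let a fourth basket in. *)
Lemma second_smallest_costs a b : 0 < a -> 0 < b ->
    a != b -> a != 2 * b -> b != 2 * a ->
  let s := second_smallest [:: a; b; 2 * a; 2 * b] in
  exists u v : nat * nat,
    [/\ uniq [:: (0, 0); u; v], v.1 * a + v.2 * b = s
      & forall p, (p.1 * a + p.2 * b <= s) = (p \in [:: (0, 0); u; v])].
Proof.
move=> a_gt0 b_gt0 ab a2b b2a s; rewrite /s second_smallest_pair.
case: ltnP => lt_ab; case: leqP => lt_s;
  [exists (1, 0), (0, 1) | exists (1, 0), (2, 0)
  | exists (0, 1), (1, 0) | exists (0, 1), (0, 2)];
  (split=> [||[i j]]; [by [] | rewrite /=; lia |]); rewrite !inE !xpair_eqE /=;
  by case: i => [|[|[|i]]]; case: j => [|[|[|j]]]; rewrite ?eqSS /=; lia.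
Qed.

(** * Excess of a way over the all-ones way *)

(** What the terms of [a] contribute beyond 1 each: with the number of terms
    fixed, ones are only padding, and minimizing the sum is minimizing this. *)
Definition excess m (a : seq nat) := \sum_(i <- a) (i ^ m - 1).

Lemma is_way_excess n m x a : is_way n m x a -> x = n + excess m a.
Proof.
case/and3P=> /eqP <- a_gt0 /eqP <-; rewrite /excess -sum1_size -big_split /=.
rewrite !big_seq; apply: eq_bigr => i /(allP a_gt0) i_gt0.
by rewrite subnKC // expn_gt0 i_gt0.
Qed.

Lemma leq_excess m a i : i \in a -> i ^ m - 1 <= excess m a.
Proof. by move=> ai; rewrite /excess (big_rem i) //= leq_addr. Qed.

(** Terms from 5 on are too expensive for a minimal sum: see [small_way]. *)
Definition small (a : seq nat) := all (fun i => 0 < i < 5) a.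

Lemma sum_small (F : nat -> nat) a : small a ->
  \sum_(i <- a) F i = count_mem 1 a * F 1 + count_mem 2 a * F 2
                    + count_mem 3 a * F 3 + count_mem 4 a * F 4.
Proof.
elim: a => [|i a IHa] /=; first by rewrite big_nil.
case/andP=> i_small /IHa; rewrite big_cons => ->.
by case: i i_small => [|[|[|[|[|i]]]]] //= _; lia.
Qed.

Lemma size_small a : small a ->
  size a = count_mem 1 a + count_mem 2 a + count_mem 3 a + count_mem 4 a.
Proof. by move=> a_small; rewrite -sum1_size (sum_small (fun=> 1)) // !muln1. Qed.

Lemma perm_small a b : small a -> small b -> size a = size b ->
  {in [:: 2; 3; 4], forall i, count_mem i a = count_mem i b} -> perm_eq a b.
Proof.
move=> a_small b_small; rewrite !size_small // => size_ab eq_ab.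
have:= (eq_ab 2 isT, eq_ab 3 isT, eq_ab 4 isT) => -[[e2 e3] e4].
have {size_ab} e1 : count_mem 1 a = count_mem 1 b.
  by move: size_ab; rewrite e2 e3 e4 => /addIn/addIn/addIn.
apply/allP=> i; rewrite mem_cat => i_ab.
have {i_ab}: 0 < i < 5.
  by case/orP: i_ab; [apply: (allP a_small) | apply: (allP b_small)].
by case: i => [|[|[|[|[|i]]]]] //= _; rewrite ?e1 ?e2 ?e3 ?e4.
Qed.

(** * Trading equal parts *)

(** The number of parts [a] in the least amount that can be paid in parts [a]
    only as well as in parts [b] only. *)
Definition copies a b := lcmn a b %/ a.

Lemma copiesK a b : copies a b * a = lcmn a b.
Proof. by rewrite divnK ?dvdn_lcml. Qed.

Lemma copies_gcd a b : 0 < a -> copies a b = b %/ gcdn a b.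
Proof.
move=> a_gt0; apply/eqP; rewrite -(eqn_pmul2r a_gt0) copiesK /lcmn.
by rewrite (mulnC (b %/ _)) muln_divA ?dvdn_gcdr.
Qed.

Lemma copies_gt0 a b : 0 < a -> 0 < b -> 0 < copies a b.
Proof.
by move=> a_gt0 b_gt0; rewrite divn_gt0 // dvdn_leq ?lcmn_gt0 ?a_gt0 ?dvdn_lcml.
Qed.

Lemma leq_copies a b : 0 < a -> a <= b -> copies b a <= copies a b.
Proof. by move=> a_gt0 ab; rewrite /copies lcmnC leq_div2l. Qed.

(** A change in the number of parts [b] that parts [a] can compensate is worth a
    common multiple of [a] and [b]. *)
Lemma eq_mod_copies a b x y x' y' : 0 < b ->
  x * b + y * a = x' * b + y' * a -> x = x' %[mod copies b a].
Proof.
move=> b_gt0; wlog x'x : x x' y y' / x' <= x => [IH|] eq_xy.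
  case: (leqP x' x) => [|/ltnW] le_x; first exact: (IH _ _ _ _ le_x eq_xy).
  exact/esym/(IH _ _ _ _ le_x)/esym/eq_xy.
apply/eqP; rewrite eqn_mod_dvd // -(dvdn_pmul2r b_gt0) copiesK dvdn_lcm.
rewrite dvdn_mull //=; have -> : (x - x') * b = (y' - y) * a by rewrite !mulnBl; lia.
exact: dvdn_mull.
Qed.

(** Each full batch of [copies b a] parts [b] is worth [copies a b] parts [a];
    only the remainder resists the trade. *)
Lemma trade_copies a b x :
  x * b = (x %% copies b a) * b + (x %/ copies b a) * copies a b * a.
Proof.
by rewrite -mulnA copiesK lcmnC -copiesK mulnA -mulnDl addnC -divn_eq.
Qed.

(** * Ways with terms at most 4 *)

(* [threes m] threes have the same excess as [twos_per3 m] twos, and one four has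
   the same excess as [twos_per4 m] twos; [twos_per3 m] is the l_3 of the theorem. *)
Notation twos_per3 m := (copies (2 ^ m - 1) (3 ^ m - 1)).
Notation threes m := (copies (3 ^ m - 1) (2 ^ m - 1)).
Notation twos_per4 m := (2 ^ m + 1).

(** The number of twos needed to replace [p.1] batches of threes and [p.2] fours. *)
Definition cost m (p : nat * nat) := p.1 * twos_per3 m + p.2 * twos_per4 m.

(** Full batches of threes, and fours: by [code_inj] this determines a way with
    terms at most 4, of given sum and length, up to order. *)
Definition code m (a : seq nat) :=
  (count_mem 3 a %/ threes m, count_mem 4 a).

Definition residue m (a : seq nat) :=
  count_mem 3 a %% threes m.

Lemma pow4_sub1 m : 4 ^ m - 1 = (2 ^ m + 1) * (2 ^ m - 1).
Proof. by rewrite -[4]/(2 ^ 2) expnAC mulnC -subn_sqr exp1n. Qed.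

(** In an amount of twos: after all possible trades only the residual threes
    cannot be turned into twos. *)
Lemma excess_code m a : small a -> excess m a =
  residue m a * (3 ^ m - 1) + (count_mem 2 a + cost m (code m a)) * (2 ^ m - 1).
Proof.
move=> a_small; rewrite /excess sum_small // exp1n subnn muln0 add0n pow4_sub1.
rewrite (trade_copies (2 ^ m - 1) (3 ^ m - 1)) /cost /= !mulnA 2!mulnDl.
by rewrite -!addnA addnCA.
Qed.

Lemma pow_sub1_gt0 k m : 1 < k -> 0 < m -> 0 < k ^ m - 1.
Proof. by move=> k_gt1 m_gt0; rewrite subn_gt0 -(expn0 k) ltn_exp2l. Qed.

(** The residual number of threes is forced by the excess modulo [2 ^ m - 1]; the
    code then gives the threes and fours, the excess gives the twos, and the
    length gives the ones. *)
Lemma code_inj m a b : 0 < m -> small a -> small b -> size a = size b ->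
    excess m a = excess m b ->
  residue m a = residue m b /\ (code m a = code m b -> perm_eq a b).
Proof.
move=> m_gt0 a_small b_small size_ab eq_ab.
have A_gt0 : 0 < 2 ^ m - 1 by exact: pow_sub1_gt0.
have B_gt0 : 0 < 3 ^ m - 1 by exact: pow_sub1_gt0.
have eq_res : residue m a = residue m b.
  have := eq_ab; rewrite !excess_code // => /(eq_mod_copies B_gt0).
  by rewrite !modn_mod.
split=> // eq_code; have [eq_k eq_4] := eq_code.
have eq_3 : count_mem 3 a = count_mem 3 b.
  by rewrite (divn_eq (count_mem 3 a) (threes m)) eq_k
       -/(residue m a) eq_res -divn_eq.
move: eq_ab; rewrite !excess_code // eq_res eq_code => /addnI/eqP.
rewrite eqn_pmul2r // => /eqP/addIn eq_2.
apply: perm_small => // i; rewrite !inE => /or3P[] /eqP -> //.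
Qed.

(** * No tie between the candidates *)

Lemma twos_per3_mul_gcd m : 0 < m ->
  twos_per3 m * gcdn (2 ^ m - 1) (3 ^ m - 1) = 3 ^ m - 1.
Proof. by move=> m_gt0; rewrite copies_gcd ?pow_sub1_gt0 // divnK // dvdn_gcdr. Qed.

Lemma odd_gcd m : 0 < m -> odd (gcdn (2 ^ m - 1) (3 ^ m - 1)).
Proof.
move=> m_gt0; apply: dvdn_odd (dvdn_gcdl _ _) _.
by rewrite oddB ?expn_gt0 // oddX; case: m m_gt0.
Qed.

Lemma odd_twos_per4 m : 0 < m -> odd (twos_per4 m).
Proof. by rewrite oddD oddX; case: m. Qed.

Lemma odd_twos_per3 m : 0 < m -> odd (twos_per3 m) = false.
Proof.
move=> m_gt0; have := congr1 odd (twos_per3_mul_gcd m_gt0).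
by rewrite oddM odd_gcd // andbT oddB ?expn_gt0 // oddX orbT.
Qed.

(** For [m] even, 4 divides [3 ^ m - 1], which is [twos_per3 m] times an odd
    number, while [2 * twos_per4 m] is twice an odd number.  For [m] odd, 3
    divides [2 ^ m + 1] but not [3 ^ m - 1]. *)
Lemma twos_per3_neq_double m : 0 < m -> twos_per3 m != 2 * twos_per4 m.
Proof.
move=> m_gt0; apply/eqP=> three_eq.
have m_eq : m = odd m + 2 * m./2 by rewrite mul2n odd_double_half.
have mul_eq : 3 ^ m - 1 = 2 * (twos_per4 m * gcdn (2 ^ m - 1) (3 ^ m - 1)).
  by rewrite mulnA -three_eq twos_per3_mul_gcd.
case m_odd: (odd m) m_eq => m_eq; last first.
  have: 4 %| 3 ^ m - 1.
    by rewrite -eqn_mod_dvd ?expn_gt0 // m_eq add0n expnM -modnXm exp1n.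
  rewrite mul_eq -[4]/(2 * 2) dvdn_pmul2l // dvdn2 oddM odd_twos_per4 //.
  by rewrite odd_gcd.
have: 3 %| 3 ^ m - 1.
  rewrite mul_eq dvdn_mull // dvdn_mulr // /dvdn [in twos_per4 m]m_eq add1n.
  by rewrite expnS expnM -modnDml -modnMmr -modnXm exp1n.
by rewrite dvdn_subr ?expn_gt0 // m_eq add1n expnS dvdn_mulr.
Qed.

(** * Affordable codes *)

Notation seed m :=
  (second_smallest [:: twos_per3 m; twos_per4 m; 2 * twos_per3 m; 2 * twos_per4 m]).

Lemma seed_costs m : 0 < m -> exists u v : nat * nat,
    [/\ uniq [:: (0, 0); u; v], cost m v = seed m
      & forall p, (cost m p <= seed m) = (p \in [:: (0, 0); u; v])].
Proof.
move=> m_gt0; have per3_even := odd_twos_per3 m_gt0.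
have per4_odd := odd_twos_per4 m_gt0.
apply: second_smallest_costs;
  rewrite ?twos_per3_neq_double ?copies_gt0 ?pow_sub1_gt0 //.
- by rewrite addn1.
- by apply: contraFneq per3_even => ->.
- by apply: contraTneq per4_odd => ->; rewrite oddM.
Qed.

(** * Three ways at the seed value *)

(** Start from [s] twos and [n - s] ones, trade twos for [p.1] batches of threes
    and [p.2] fours, and restore the length with ones. *)
Definition spread m n s (p : nat * nat) :=
  let c2 := s - cost m p in
  let c3 := p.1 * threes m in
  nseq (n - (c2 + (c3 + p.2))) 1 ++ nseq c2 2 ++ nseq c3 3 ++ nseq p.2 4.

(** The trades never lengthen the list, since they replace twos by fewer and
    larger terms; so there is room for the ones. *)
Lemma is_way_spread m n s p : 0 < m -> s <= n -> cost m p <= s ->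
  is_way n m (n + s * (2 ^ m - 1)) (spread m n s p).
Proof.
move=> m_gt0 s_le_n p_le_s.
have p_small : small (spread m n s p).
  by rewrite /small !all_cat !all_nseq !orbT.
have sp_size : size (spread m n s p) = n.
  rewrite /spread !size_cat !size_nseq subnK //.
  apply: leq_trans s_le_n; rewrite -[leqRHS](subnK p_le_s) leq_add2l.
  rewrite leq_add // ?leq_pmulr ?addn1 // leq_mul2l leq_copies ?orbT ?pow_sub1_gt0 //.
  by rewrite leq_sub2r // leq_exp2r.
have sp_all : all (fun i => 0 < i) (spread m n s p).
  by apply: sub_all p_small => i /andP[].
suff sp_excess : excess m (spread m n s p) = s * (2 ^ m - 1).
  rewrite /is_way sp_size eqxx sp_all -sp_excess -{2}sp_size /=.
  by apply/eqP/is_way_excess; rewrite /is_way sp_all !eqxx.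
have q_gt0 : 0 < threes m.
  by rewrite copies_gt0 ?pow_sub1_gt0.
rewrite excess_code // /residue /code /spread !count_cat !count_nseq /=.
by rewrite !mul0n !mul1n !add0n !addn0 mulnK // modnMl -surjective_pairing subnK.
Qed.

Lemma spread_inj m n s p p' : 0 < m ->
  perm_eq (spread m n s p) (spread m n s p') -> p = p'.
Proof.
move=> m_gt0 /permP eq_count.
have q_gt0 : 0 < threes m.
  by rewrite copies_gt0 ?pow_sub1_gt0.
have := (eq_count (pred1 3), eq_count (pred1 4)).
rewrite /spread !count_cat !count_nseq /= !mul0n !mul1n !add0n !addn0.
case=> /eqP; rewrite eqn_pmul2r // => /eqP.
by case: p p' {eq_count} => [k c] [k' c'] /= -> ->.
Qed.

Lemma three_ways_seed m n : 0 < m -> seed m <= n ->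
  at_least_ways n m 3 (n + seed m * (2 ^ m - 1)).
Proof.
move=> m_gt0 s_le_n; have [u [v [uniq_uv _ in_uv]]] := seed_costs m_gt0.
exists (map (spread m n (seed m)) [:: (0, 0); u; v]); split=> //.
  by apply/allP=> _ /mapP[p pL ->]; rewrite is_way_spread // in_uv.
rewrite pairwise_map; move: uniq_uv; rewrite uniq_pairwise.
by apply: sub_pairwise => p p' /=; apply: contra => /spread_inj ->.
Qed.

(** * Optimality of the seed value *)

Lemma double_pow4_lt_pow5 m : 4 <= m -> 2 * (4 ^ m - 1) < 5 ^ m - 1.
Proof.
move=> m_ge4; suff: 2 * 4 ^ m <= 5 ^ m by have := expn_gt0 4 m; lia.
rewrite -(subnKC m_ge4) !expnD mulnA leq_mul //.
by case: (m - 4) => // k; rewrite leq_exp2r.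
Qed.

(** The seed is at most [2 * twos_per4 m], so an affordable excess is at most
    that of two fours, which is less than that of a single 5. *)
Lemma small_way m n x a : 4 <= m -> is_way n m x a ->
  x <= n + seed m * (2 ^ m - 1) -> small a.
Proof.
move=> m_ge4 a_way; rewrite (is_way_excess a_way) leq_add2l => a_le.
have seed_le : seed m <= 2 * twos_per4 m by rewrite second_smallest_pair; case: ltnP; lia.
case/and3P: a_way => _ a_gt0 _; apply/allP=> i ai; rewrite (allP a_gt0) //=.
rewrite ltnNge; apply/negP=> i_ge5.
have := double_pow4_lt_pow5 m_ge4; rewrite ltnNge => /negP; apply.
rewrite pow4_sub1 mulnA; apply: leq_trans (leq_mul seed_le (leqnn _)).
apply: leq_trans a_le; apply: leq_trans (leq_excess m ai).
by rewrite leq_sub2r // leq_exp2r // (leq_trans _ m_ge4).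
Qed.

(** Ways with an affordable sum have distinct affordable codes, and there are
    only three of these, so three ways use all of them.  The code of cost
    [seed m] forces the sum to be at least the claimed one; the code [(0, 0)] then
    belongs to the way with [seed m] twos, which needs that many terms. *)
Lemma seed_optimal m n x : 4 <= m -> at_least_ways n m 3 x ->
  x <= n + seed m * (2 ^ m - 1) -> x = n + seed m * (2 ^ m - 1) /\ seed m <= n.
Proof.
move=> m_ge4 [W [size_W W_ways W_pairwise]] x_le.
have m_gt0 : 0 < m by apply: leq_trans m_ge4.
have A_gt0 : 0 < 2 ^ m - 1 by rewrite pow_sub1_gt0.
have [u [v [uniq_uv v_cost in_uv]]] := seed_costs m_gt0.
set L := [:: _; u; v] in uniq_uv in_uv.
have W_way a : a \in W -> is_way n m x a by move/(allP W_ways).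
have W_small a : a \in W -> small a by move/W_way/small_way; apply.
have W_size a : a \in W -> size a = n by case/W_way/and3P=> /eqP.
have W_excess a : a \in W -> x = n + excess m a by move/W_way/is_way_excess.
have W_eq a b : a \in W -> b \in W ->
  residue m a = residue m b /\ (code m a = code m b -> perm_eq a b).
  move=> aW bW; apply: code_inj; rewrite ?W_small ?W_size //.
  by apply: (@addnI n); rewrite -!W_excess.
have W_L : {subset map (code m) W <= L}.
  move=> _ /mapP[a aW ->]; rewrite -in_uv.
  move: x_le; rewrite (W_excess a) // leq_add2l excess_code ?W_small //.
  move/(leq_trans (leq_addl _ _)); rewrite leq_pmul2r //.
  exact: leq_trans (leq_addl _ _).
have uniq_W : uniq (map (code m) W).
  rewrite uniq_pairwise pairwise_map; move: W_pairwise.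
  apply: sub_in_pairwise (allss W) => a b aW bW /=.
  by apply: contra => /eqP /(proj2 (W_eq a b aW bW)).
have [_ L_W] : size (map (code m) W) = size L /\ map (code m) W =i L.
  by have [] := uniq_min_size uniq_W W_L; rewrite // size_map size_W.
have /mapP[b bW b_code] : v \in map (code m) W by rewrite L_W !inE eqxx !orbT.
have /mapP[a aW a_code] : (0, 0) \in map (code m) W by rewrite L_W inE eqxx.
have b_excess := excess_code m (W_small b bW).
have a_excess := excess_code m (W_small a aW).
rewrite -b_code v_cost in b_excess; rewrite -a_code /cost /= !mul0n !addn0 in a_excess.
have [res_ab _] := W_eq a b aW bW.
have b_le : excess m b <= seed m * (2 ^ m - 1).
  by move: x_le; rewrite (W_excess b bW) leq_add2l.
have: residue m b * (3 ^ m - 1) + count_mem 2 b * (2 ^ m - 1) == 0.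
  by move: b_le; rewrite b_excess mulnDl addnA -[leqRHS]add0n leq_add2r leqn0.
rewrite addn_eq0 => /andP[res_b /eqP count_b].
have {count_b} b_eq : excess m b = seed m * (2 ^ m - 1).
  by rewrite b_excess (eqP res_b) mulnDl count_b.
have a_eq : excess m a = seed m * (2 ^ m - 1).
  by apply: (@addnI n); rewrite -b_eq -!W_excess.
split; first by rewrite -a_eq -W_excess.
move/eqP: a_eq; rewrite a_excess res_ab (eqP res_b) add0n eqn_pmul2r // => /eqP <-.
by rewrite -(W_size a aW) count_size.
Qed.

(** * The seed number *)

Lemma is_T_seed m n : 4 <= m -> seed m <= n ->
  is_T n m 3 (n + seed m * (2 ^ m - 1)).
Proof.
move=> m_ge4 s_le_n; split.
  by apply: three_ways_seed => //; apply: leq_trans m_ge4.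
move=> y /(seed_optimal m_ge4) y_opt.
by case: (leqP y (n + seed m * (2 ^ m - 1))) => [/y_opt[->] //|/ltnW].
Qed.

Lemma is_T_unique n m t x y : is_T n m t x -> is_T n m t y -> x = y.
Proof.
by move=> [x_ways x_min] [y_ways y_min]; apply/eqP; rewrite eqn_leq x_min ?y_min.
Qed.

(** If a smaller bound had the seed property, the least value for [seed m - 1]
    terms would be one below that for [seed m] terms, and reaching it in three
    ways takes [seed m] terms. *)
Lemma seed_number_seed m : 4 <= m -> is_seed_number m 3 (seed m).
Proof.
move=> m_ge4; split.
  split.
    rewrite second_smallest_pair.
    have: 0 < twos_per3 m by rewrite copies_gt0 ?pow_sub1_gt0 // (leq_trans _ m_ge4).
    by case: (ltnP (twos_per3 m)); lia.
  move=> n s_le_n; exists (n + seed m * (2 ^ m - 1)); rewrite -addSn.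
  by split; apply: is_T_seed => //; apply: leqW.
move=> s' [s'_gt0 s'_seed]; rewrite leqNgt; apply/negP=> lt_s.
have [|x []] := s'_seed (seed m).-1; first by rewrite -ltnS prednK // (leq_trans _ lt_s).
have s_gt0 : 0 < seed m by apply: leq_trans lt_s.
rewrite prednK // => -[x_ways _] /is_T_unique /(_ (is_T_seed m_ge4 (leqnn _))).
rewrite -{1}(prednK s_gt0) addSn => -[x_eq].
have [] := seed_optimal m_ge4 x_ways; first by rewrite x_eq.
by move=> _; rewrite leqNgt prednK // leqnn.
Qed.

Theorem theorem4p3 (m : nat) (hm : 4 <= m) :
  let d := gcdn (3 ^ m - 2 ^ m) (2 ^ m - 1) in
  let l3 := (3 ^ m - 1) %/ d in
  let l4 := 2 ^ m + 1 in
  let s := second_smallest [:: l3; l4; 2 * l3; 2 * l4] in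
  is_seed_number m 3 s /\ is_seed_value m 3 (s * 2 ^ m).
Proof.
move=> d l3 l4 s.
have -> : s = seed m.
  rewrite /s; have -> : l3 = twos_per3 m; last by [].
  rewrite copies_gcd ?pow_sub1_gt0 ?(leq_trans _ hm) // /l3 /d.
  (* The gcd depends only on [3 ^ m - 2 ^ m] modulo [2 ^ m - 1]. *)
  congr (_ %/ _); rewrite gcdnC -gcdnDr; congr gcdn.
  by rewrite addnBA ?expn_gt0 // subnK // leq_exp2r // (leq_trans _ hm).
split; first exact: seed_number_seed.
exists (seed m); split; first exact: seed_number_seed.
have -> : seed m * 2 ^ m = seed m + seed m * (2 ^ m - 1).
  by rewrite -mulnS subn1 prednK ?expn_gt0.
exact: is_T_seed.
Qed.
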